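(* Let $f:\mathbb{T}\to\mathbb{C}$ be a continuous function with $\sup_{\zeta\in\mathbb{T}}|f(\zeta)|\le 1$, and let $\varepsilon>0$. Then there are an integer $n\ge1$, finite Blaschke products $B_{i1},B_{i2}$ ($1\le i\le n$) and convex weights $(\lambda_j)_{1\le j\le n}$ such that $$\left\|\lambda_1\frac{B_{11}}{B_{12}}+\lambda_2\frac{B_{21}}{B_{22}}+\cdots+\lambda_n\frac{B_{n1}}{B_{n2}}-f\right\|_{\mathcal{C}(\mathbb{T})}<\varepsilon.$$
   Context: $\mathbb{D}$ is the open unit disc and $\mathbb{T}$ the unit circle in $\mathbb{C}$. $\mathcal{C}(\mathbb{T})$ is the space of continuous complex-valued functions on $\mathbb{T}$ with the supremum norm $\|\cdot\|_{\mathcal{C}(\mathbb{T})}$. A finite Blaschke product is a function of the form $B(z)=c\prod_{k=1}^m\frac{a_k-z}{1-\overline{a}_k z}$ with $m\ge 0$, $a_1,\dots,a_m\in\mathbb{D}$ and $c\in\mathbb{C}$, $|c|=1$; it is regarded here as a function on $\mathbb{T}$. Convex weights are real numbers $0\le\lambda_j\le1$ with $\lambda_1+\cdots+\lambda_n=1$. *)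

(* Defs.v *)
From HB Require Import structures.
From mathcomp Require Export all_boot all_order all_algebra.
From mathcomp Require Export all_classical all_reals all_analysis.
From mathcomp Require Export complex.

Set Implicit Arguments.
Unset Strict Implicit.
Unset Printing Implicit Defensive.

Export Order.TTheory GRing.Theory Num.Theory.
Export numFieldNormedType.Exports.

Local Open Scope classical_set_scope.
Local Open Scope ring_scope.
Local Open Scope complex_scope.

(* `|z| : R[i], so that `|z| < 1 and `|z| = 1 are comparisons in R[i]. *)
Definition unit_disc (R : realType) : set R[i] := [set z | `|z| < 1].

Definition unit_circle (R : realType) : set R[i] := [set z | `|z| = 1].

(* A function on the circle is represented by a function on R[i] whose values
   off the circle play no role.  R[i]^o is R[i] with the topology given by
   the balls {w | `|z - w| < e}; here e : R[i], and 0 < e makes it real. *)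
Definition continuous_on_circle (R : realType) (g : R[i] -> R[i]) : Prop :=
  {within (@unit_circle R : set R[i]^o), continuous (g : R[i]^o -> R[i]^o)}.

(* `|g z| is the element (normc (g z))%:C of R[i]; Re reads it in R.  The
   supremum is taken in \bar R, so it is +oo if g is unbounded on the circle. *)
Definition circle_norm (R : realType) (g : R[i] -> R[i]) : \bar R :=
  ereal_sup [set (complex.Re `|g z|)%:E | z in @unit_circle R].

Definition finite_Blaschke_product (R : realType) (B : R[i] -> R[i]) : Prop :=
  exists (c : R[i]) (a : seq R[i]),
    [/\ `|c| = 1,
        (forall w, w \in a -> unit_disc w)
      & {in @unit_circle R, forall z,
          B z = c * \prod_(w <- a) ((w - z) / (1 - w^* * z))}].

Definition convex_weights (R : realType) (n : nat) (lambda : 'I_n -> R) : Prop :=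
  (forall j, 0 <= lambda j <= 1) /\ \sum_(j < n) lambda j = 1.

(* Main.v *)
(* With K_j(z) proportional to |1 + z w^j|^(2N), w a primitive root of unity of
   order n > N + 1, the sum of the K_j(z) is 1 and their second moment about z
   is 2 / (N + 1); hence z |-> sum_j K_j(z) f(w^-j) is a trigonometric polynomial
   z^-N q(z) bounded by 1 and uniformly close to f.  Shrinking it slightly to a
   function a with |a| < 1, the average over n-th roots of unity u of the
   unimodular functions (a + u) / (u conj(a + u)) converges to a.  Such a function
   is P / conj(P) on the circle for a polynomial P, up to a constant and a power
   of z, and factoring P exhibits it as a quotient of Blaschke products. *)
Require Import Defs.
From mathcomp Require Import separable cyclotomic cyclic.
From mathcomp Require Import ring lra zify.

Set Implicit Arguments.
Unset Strict Implicit.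
Unset Printing Implicit Defensive.

Local Open Scope classical_set_scope.
Local Open Scope ring_scope.
Local Open Scope complex_scope.

(** * Roots of unity and numbers of modulus one *)

(** Separability of [X^n - 1] in characteristic 0 gives [n] distinct roots, and such a full set of
    [n]-th roots of unity contains a primitive one. *)
Lemma closed_prim_root_exists (C : numClosedFieldType) (n : nat) :
  (0 < n)%N -> exists w : C, n.-primitive_root w.
Proof.
move=> n_gt0; have [r Dp] := closed_field_poly_normal ('X^n - 1 : {poly C}).
rewrite (monicP _) ?monicXnsubC // scale1r in Dp.
have rn1 : all n.-unity_root r by apply/allP => z; rewrite -root_prod_XsubC -Dp.
have sz_r : (n < (size r).+1)%N.
  by rewrite -(size_prod_XsubC r id) -Dp size_XnsubC.
have [|z] := hasP (has_prim_root n_gt0 rn1 _ sz_r); last by exists z.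
by rewrite -separable_prod_XsubC -Dp separable_Xn_sub_1 // pnatr_eq0 -lt0n.
Qed.

Lemma sum_expr_prim_root (F : fieldType) (n : nat) (w : F) (k : nat) :
  n.-primitive_root w ->
  \sum_(j < n) (w ^+ j) ^+ k = if (n %| k)%N then n%:R else 0.
Proof.
move=> w_prim; case: ifPn => [|]; rewrite (prim_order_dvd w_prim) => wk.
  rewrite (eq_bigr (fun=> 1)) ?sumr_const ?card_ord// => j _.
  by rewrite exprAC (eqP wk) expr1n.
apply: (mulfI (_ : w ^+ k - 1 != 0)); first by rewrite subr_eq0.
under eq_bigr do rewrite exprAC.
by rewrite -subrX1 mulr0 exprAC (prim_expr_order w_prim) expr1n subrr.
Qed.

Lemma norm_prim_root (C : numClosedFieldType) (n : nat) (w : C) :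
  n.-primitive_root w -> `|w| = 1.
Proof.
move=> w_prim; apply/eqP.
rewrite -(@pexpr_eq1 _ _ n) ?(prim_order_gt0 w_prim)//.
by rewrite -normrX (prim_expr_order w_prim) normr1.
Qed.

Lemma conj_unit (C : numClosedFieldType) (z : C) : `|z| = 1 -> z^*%R = z^-1.
Proof. by move=> z1; rewrite invC_norm z1 expr1n invr1 mul1r. Qed.

Lemma unit_neq0 (C : numClosedFieldType) (z : C) : `|z| = 1 -> z != 0.
Proof. by move=> z1; rewrite -normr_eq0 z1 oner_eq0. Qed.

(** * Approximation by trigonometric polynomials with a discrete Fejer-type kernel *)

(** Since [conj z = 1 / z], even powers of [|1 + z|] are Laurent polynomials in [z]; this is what
    makes the kernel a trigonometric polynomial. *)
Lemma normDsqr_unit (C : numClosedFieldType) (z : C) :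
  `|z| = 1 -> `|1 + z| ^+ 2 = (1 + z) ^+ 2 / z.
Proof.
move=> z1; rewrite normCK rmorphD rmorph1 /= (conj_unit z1).
by field; rewrite unit_neq0.
Qed.

(** Each summand is a Laurent polynomial in [w ^+ j] with degrees from [-N] to [N]. Summing over [j]
    keeps the degrees divisible by [n > N], that is, only the central binomial term. *)
Lemma sum_normD_prim_root (C : numClosedFieldType) (n N : nat) (w z : C) :
  n.-primitive_root w -> (N < n)%N -> `|z| = 1 ->
  \sum_(j < n) `|1 + z * w ^+ j| ^+ N.*2 = (n * 'C(N.*2, N))%:R.
Proof.
move=> w_prim Nn z1.
have w1 := norm_prim_root w_prim.
have w0 := unit_neq0 w1; have z0 := unit_neq0 z1.
(* The exponent [k + (n - N)] replaces [k - N], which may be negative; they agree modulo [n]. *)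
transitivity (\sum_(j < n) \sum_(k < N.*2.+1)
    ('C(N.*2, k)%:R * z ^+ k / z ^+ N) * (w ^+ j) ^+ (k + (n - N))).
  apply: eq_bigr => j _; have u1 : `|z * w ^+ j| = 1.
    by rewrite normrM normrX z1 w1 expr1n mulr1.
  have wnN : (w ^+ j) ^+ (n - N) = ((w ^+ j) ^+ N)^-1.
    apply: (mulIf (_ : (w ^+ j) ^+ N != 0)); first by rewrite !expf_neq0.
    rewrite -exprD subnK ?(ltnW Nn)// mulVf ?expf_neq0//.
    by rewrite exprAC (prim_expr_order w_prim) expr1n.
  rewrite -mul2n exprM normDsqr_unit// expr_div_n -exprM mul2n exprDn.
  rewrite mulr_suml; apply: eq_bigr => k _.
  rewrite expr1n mul1r exprD wnN !exprMn invfM -mulr_natl; ring.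
rewrite exchange_big /=.
have Ndbl : (N < N.*2.+1)%N by rewrite ltnS -addnn leq_addr.
rewrite (bigD1 (Ordinal Ndbl)) //= [X in _ + X]big1 ?addr0 => [|k kN].
  rewrite -mulr_sumr (sum_expr_prim_root _ w_prim) subnKC ?(ltnW Nn)// dvdnn.
  by rewrite mulfK ?expf_neq0// natrM mulrC.
rewrite -mulr_sumr (sum_expr_prim_root _ w_prim) ifN ?mulr0//.
(* As [k + (n - N)] lies strictly between [0] and [2n], it can only be the multiple [n] itself. *)
apply: contra kN => /dvdnP[q kq]; apply/eqP/val_inj => /=.
have := ltn_ord k; move: kq Nn.
case: q => [|[|q]]; first by rewrite mul0n; lia.
  by rewrite mul1n; lia.
rewrite !mulSn; lia.
Qed.

Lemma normDsqr_normBsqr_unit (C : numClosedFieldType) (z : C) :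
  `|z| = 1 -> `|1 + z| ^+ 2 + `|1 - z| ^+ 2 = 4.
Proof.
move=> z1; have Nz1 : `|- z| = 1 by rewrite normrN.
rewrite !normDsqr_unit//; field.
by rewrite unit_neq0.
Qed.

(** The ratio of consecutive central binomial coefficients, [4 - 2 / (N + 1)]; its defect from 4 is
    the second moment of the kernel. *)
Lemma mulS_bin_doubleS (N : nat) :
  (N.+1 * 'C(N.+1.*2, N.+1) = N.*2.+1.*2 * 'C(N.*2, N))%N.
Proof.
have e1 := mul_bin_diag N.*2.+1 N; have e2 := mul_bin_diag N.*2 N.
have e3 := mul_bin_down N.*2.+2 N.+1; have e4 := mul_bin_down N.*2.+1 N.
rewrite doubleS; move: e1 e2 e3 e4 => /=.
have -> : (N.*2.+1 - N = N.+1)%N by lia.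
have -> : (N.*2.+2 - N.+1 = N.+1)%N by lia.
nia.
Qed.

(* The second moment of the weights about z is that of a Fejer-type kernel:
   |z - w^-j|^2 = 4 - |1 - z w^j|^2 trades it for two consecutive central
   binomial coefficients. *)
Lemma sum_normD_dist (C : numClosedFieldType) (n N : nat) (w z : C) :
  n.-primitive_root w -> (N.+1 < n)%N -> `|z| = 1 ->
  \sum_(j < n) `|1 + z * w ^+ j| ^+ N.*2 * `|z - (w ^+ j)^-1| ^+ 2 =
  2 / N.+1%:R * (n * 'C(N.*2, N))%:R.
Proof.
move=> w_prim Nn z1.
have w1 := norm_prim_root w_prim.
transitivity (\sum_(j < n) (4 * `|1 + z * w ^+ j| ^+ N.*2
                            - `|1 + z * w ^+ j| ^+ N.+1.*2)).
  apply: eq_bigr => j _; rewrite doubleS -[N.*2.+2]addn2 exprD.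
  have wj1 : `|w ^+ j| = 1 by rewrite normrX w1 expr1n.
  have u1 : `|z * w ^+ j| = 1 by rewrite normrM wj1 z1 mulr1.
  have -> : `|z - (w ^+ j)^-1| = `|1 - z * w ^+ j|.
    rewrite -[LHS]mulr1 -{1}wj1 -normrM mulrBl mulVf ?unit_neq0//.
    exact: distrC.
  rewrite -(normDsqr_normBsqr_unit u1); ring.
rewrite big_split -mulr_sumr sumrN /= !(sum_normD_prim_root w_prim)// ?(ltnW Nn)//.
have := congr1 (fun k => k%:R : C) (mulS_bin_doubleS N).
rewrite !natrM -!muln2 -[(_ * 2).+1]addn1 !(natrM, natrD) => e.
apply: (mulfI (_ : N.+1%:R != 0)); first by rewrite pnatr_eq0.
rewrite mulrBr (mulrCA N.+1%:R n%:R) e -[in LHS]natr1; field.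
by rewrite -mulrS pnatr_eq0.
Qed.

(** A Chebyshev-type argument: nodes within [d] of [z] cost at most [e], and the weight of the
    others is controlled by the second moment [2 / (N + 1)]. *)
Lemma Fejer_approx (C : numClosedFieldType) (f : C -> C) (N : nat) (d e : C) :
  (forall z, `|z| = 1 -> `|f z| <= 1) -> 0 < d -> 0 <= e ->
  (forall x y, `|x| = 1 -> `|y| = 1 -> `|x - y| < d -> `|f x - f y| <= e) ->
  exists q : {poly C}, forall z, `|z| = 1 ->
    `|q.[z] / z ^+ N| <= 1 /\
    `|q.[z] / z ^+ N - f z| <= e + 4 / (d ^+ 2 * N.+1%:R).
Proof.
move=> f1 d0 e0 fd.
have [w w_prim] := @closed_prim_root_exists C N.+2 isT.
have w1 := norm_prim_root w_prim.
have wj1 j : `|w ^+ j| = 1 by rewrite normrX w1 expr1n.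
have [c c0 cE] : exists2 c : C, 0 < c & c = (N.+2 * 'C(N.*2, N))%:R.
  eexists; last by [].
  by rewrite ltr0n muln_gt0 bin_gt0 -addnn leq_addr.
(* This is [z ^+ N] times the kernel average of [f]: the factor [(z * w ^+ j) ^+ N] in the
   denominator of the kernel is split between [z] and the coefficients. *)
pose q := \sum_(j < N.+2)
  (f (w ^+ j)^-1 / (c * (w ^+ j) ^+ N)) *: (1 + w ^+ j *: 'X) ^+ N.*2.
exists q => z z1.
pose K j := `|1 + z * w ^+ j| ^+ N.*2.
have K0 j : 0 <= K j by rewrite exprn_ge0.
have sumK : \sum_(j < N.+2) K j = c by rewrite cE; exact: sum_normD_prim_root.
have fj1 j : `|f (w ^+ j)^-1| <= 1 by apply: f1; rewrite normfV wj1 invr1.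
have qE : q.[z] / z ^+ N = c^-1 * \sum_(j < N.+2) K j * f (w ^+ j)^-1.
  rewrite horner_sum mulr_suml mulr_sumr; apply: eq_bigr => j _.
  have u1 : `|z * w ^+ j| = 1 by rewrite normrM wj1 z1 mulr1.
  rewrite /K !hornerE -mul2n !exprM normDsqr_unit// expr_div_n.
  rewrite (mulrC z) [(w ^+ j * z) ^+ N]exprMn /=.
  set A := (_ ^+ 2) ^+ N; field.
  by rewrite (gt_eqF c0) !expf_neq0 ?unit_neq0.
rewrite qE; split.
  rewrite normrM normfV (gtr0_norm c0) ler_pdivrMl// mulr1 -sumK.
  apply: le_trans (ler_norm_sum _ _ _) _; apply: ler_sum => j _.
  by rewrite normrM (ger0_norm (K0 j)) ler_piMr.
have -> : f z = c^-1 * \sum_(j < N.+2) K j * f z.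
  by rewrite -mulr_suml sumK mulKf// gt_eqF.
rewrite -mulrBr -sumrB normrM normfV (gtr0_norm c0) ler_pdivrMl//.
(* One bound covers both cases: at distance at least [d] the trivial bound 2 is at most [2 / d ^+ 2]
   times the squared distance. *)
have fjz j : `|f (w ^+ j)^-1 - f z| <= e + 2 / d ^+ 2 * `|z - (w ^+ j)^-1| ^+ 2.
  have V1 : `|(w ^+ j)^-1| = 1 by rewrite normfV wj1 invr1.
  have [zd|dz] := real_ltP (normr_real (z - (w ^+ j)^-1)) (gtr0_real d0).
    apply: le_trans (_ : e <= _); last first.
      by rewrite lerDl mulr_ge0 ?divr_ge0 ?exprn_ge0// ltW.
    by apply: fd => //; rewrite distrC.
  apply: le_trans (_ : 2 <= _).
    apply: le_trans (ler_normB _ _) _.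
    by rewrite -[leRHS]/(1 + 1) lerD ?fj1 ?f1.
  rewrite ler_wpDl// mulrAC ler_pdivlMr ?exprn_gt0// ler_pM2l ?ltr0n//.
  by rewrite lerXn2r ?nnegrE// ltW.
apply: (@le_trans _ _ (\sum_(j < N.+2)
    (K j * e + 2 / d ^+ 2 * (K j * `|z - (w ^+ j)^-1| ^+ 2)))).
  apply: le_trans (ler_norm_sum _ _ _) _; apply: ler_sum => j _.
  rewrite -mulrBr normrM (ger0_norm (K0 j)) mulrCA -mulrDr.
  by apply: ler_wpM2l.
rewrite big_split /= -mulr_suml -mulr_sumr sumK sum_normD_dist// -cE.
rewrite le_eqVlt; apply/orP; left; apply/eqP.
rewrite -natr1; field.
by rewrite (gt_eqF d0) andbT -mulrS pnatr_eq0.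
Qed.

(** * Averages of Moebius maps over roots of unity *)

(* The circle averages of the Moebius maps u |-> (a + u) / (1 + a^* u) equal a;
   over the n-th roots of unity the expansion in powers of u leaves only the
   terms of degree divisible by n. *)
Lemma Moebius_average (C : numClosedFieldType) (n : nat) (w a : C) :
  n.-primitive_root w -> `|a| < 1 ->
  `|n%:R^-1 * (\sum_(j < n) (a + w ^+ j) / (w ^+ j * (a + w ^+ j)^*%R)) - a|
    <= 2 * `|a| ^+ n.-1 / (1 - `|a|).
Proof.
move=> w_prim a1; have n0 := prim_order_gt0 w_prim.
have w1 := norm_prim_root w_prim.
have wj1 j : `|w ^+ j| = 1 by rewrite normrX w1 expr1n.
pose b := - a^*%R; have nb : `|b| = `|a| by rewrite normrN norm_conjC.
have bn1 : `|b ^+ n| <= `|a|.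
  by rewrite normrX nb -(prednK n0) exprS ler_piMr// exprn_ile1// ltW.
have Bn0 : 1 - b ^+ n != 0.
  rewrite subr_eq0 eq_sym; apply: contraTneq bn1 => ->.
  by rewrite normr1 -real_ltNge ?normr_real.
set S := \sum_(j < n) _.
have nC : n%:R != 0 :> C by rewrite pnatr_eq0 -lt0n.
(* Since [(w ^+ j) ^+ n = 1], the factor [1 - b ^+ n] clears every denominator [1 - b * w ^+ j]
   through a finite geometric sum. Only [k = 0] in the first part and [k = n - 1] in the second
   survive summation over [j]. *)
have SE : S * (1 - b ^+ n) = n%:R * (a + b ^+ n.-1).
  rewrite mulr_suml.
  transitivity (\sum_(j < n) \sum_(k < n)
      (a * b ^+ k * (w ^+ j) ^+ k + b ^+ k * (w ^+ j) ^+ k.+1)).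
    apply: eq_bigr => j _.
    rewrite rmorphD /= (conj_unit (wj1 j)) [w ^+ j * (_ + _)]mulrDr mulfV ?unit_neq0//.
    have bw : 1 - b * w ^+ j != 0.
      rewrite subr_eq0 eq_sym; apply: contraTneq a1 => bw.
      by rewrite -nb -[`|b|]mulr1 -{1}(wj1 j) -normrM bw normr1 ltxx.
    have -> : w ^+ j * a^*%R + 1 = 1 - b * w ^+ j by rewrite /b; ring.
    have -> : 1 - b ^+ n = (1 - b * w ^+ j) * \sum_(k < n) (b * w ^+ j) ^+ k.
      apply: oppr_inj; rewrite -mulNr !opprB -subrX1 exprMn (exprAC w).
      by rewrite (prim_expr_order w_prim) expr1n mulr1.
    rewrite mulrA divfK// mulr_sumr; apply: eq_bigr => k _.
    rewrite exprMn exprS; ring.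
  rewrite exchange_big /=.
  transitivity (\sum_(k < n) (a * b ^+ k * (if (n %| k)%N then n%:R else 0)
                      + b ^+ k * (if (n %| k.+1)%N then n%:R else 0))).
    apply: eq_bigr => k _; rewrite big_split /= -!mulr_sumr.
    by rewrite !(sum_expr_prim_root _ w_prim).
  rewrite big_split /= mulrDr; congr (_ + _).
    rewrite (bigD1 (Ordinal n0)) //= big1 ?addr0 ?dvdn0 => [|k k0]; first ring.
    rewrite ifN ?mulr0//; apply: contra k0 => /dvdn_leq.
    by have := ltn_ord k; rewrite -val_eqE /=; case: (val k) => // m; lia.
  have pn : (n.-1 < n)%N by rewrite prednK.
  rewrite (bigD1 (Ordinal pn)) //= big1 ?addr0 ?(prednK n0) ?dvdnn => [|k kn].
    by rewrite mulrC.
  rewrite ifN ?mulr0//; apply: contra kn => /dvdn_leq.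
  by have := ltn_ord k; rewrite -val_eqE /=; lia.
have -> : n%:R^-1 * S - a = (b ^+ n.-1 + a * b ^+ n) / (1 - b ^+ n).
  apply: (mulIf Bn0); rewrite divfK// mulrBl -mulrA SE mulKf//; ring.
rewrite normf_div ler_pM ?invr_ge0//.
  apply: le_trans (ler_normD _ _) _; rewrite normrM !normrX nb.
  rewrite mulr2n mulrDl mul1r lerD2l -exprS.
  by rewrite ler_wiXn2l// ?ltW// (leq_trans (leq_pred n)).
rewrite lef_pV2 ?posrE ?subr_gt0 ?normr_gt0//.
apply: le_trans (lerB_dist _ _); rewrite normr1 lerD2l lerN2//.
Qed.

(** * Quotients of finite Blaschke products *)

(** Equality is asked on the circle only, so that [g] may be written with conjugates, as in
    [P / conj P]. *)
Definition Blaschke_quotient (R : realType) (g : R[i] -> R[i]) : Prop :=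
  exists B1 B2, [/\ finite_Blaschke_product B1, finite_Blaschke_product B2
    & forall z, unit_circle z -> g z = B1 z / B2 z].

Lemma finite_Blaschke_product_mul (R : realType) (A B : R[i] -> R[i]) :
  finite_Blaschke_product A -> finite_Blaschke_product B ->
  finite_Blaschke_product (fun z => A z * B z).
Proof.
move=> [c [a [c1 a1 AE]]] [d [b [d1 b1 BE]]]; exists (c * d), (a ++ b).
split=> [|w|z z1]; first by rewrite normrM c1 d1 mulr1.
  by rewrite mem_cat => /orP[/a1|/b1].
by rewrite AE// BE// big_cat /=; ring.
Qed.

Lemma finite_Blaschke_product_cst (R : realType) (c : R[i]) :
  `|c| = 1 -> finite_Blaschke_product (fun=> c).
Proof. by move=> c1; exists c, [::]; split=> // z _; rewrite big_nil mulr1. Qed.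

Lemma Blaschke_quotient_mul (R : realType) (g h : R[i] -> R[i]) :
  Blaschke_quotient g -> Blaschke_quotient h ->
  Blaschke_quotient (fun z => g z * h z).
Proof.
move=> [A [B [hA hB gE]]] [A' [B' [hA' hB' hE]]].
exists (fun z => A z * A' z), (fun z => B z * B' z).
split; [exact: finite_Blaschke_product_mul..|move=> z z1].
by rewrite gE// hE// mulf_div.
Qed.

Lemma Blaschke_quotient_inv (R : realType) (g : R[i] -> R[i]) :
  Blaschke_quotient g -> Blaschke_quotient (fun z => (g z)^-1).
Proof.
move=> [A [B [hA hB gE]]]; exists B, A; split=> // z z1.
by rewrite gE// invf_div.
Qed.

Lemma eq_Blaschke_quotient (R : realType) (g h : R[i] -> R[i]) :
  (forall z, `|z| = 1 -> g z = h z) ->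
  Blaschke_quotient g -> Blaschke_quotient h.
Proof.
move=> gh [A [B [hA hB gE]]]; exists A, B; split=> // z z1.
by rewrite -gh// gE.
Qed.

Lemma Blaschke_quotient_product (R : realType) (B : R[i] -> R[i]) :
  finite_Blaschke_product B -> Blaschke_quotient B.
Proof.
move=> hB; exists B, (fun=> 1); split=> // [|z _]; last by rewrite divr1.
by apply: finite_Blaschke_product_cst; rewrite normr1.
Qed.

Lemma Blaschke_quotient_cst (R : realType) (c : R[i]) :
  `|c| = 1 -> Blaschke_quotient (fun=> c).
Proof.
by move=> c1; exact/Blaschke_quotient_product/finite_Blaschke_product_cst.
Qed.

Lemma Blaschke_quotient_factor (R : realType) (r : R[i]) :
  `|r| < 1 -> Blaschke_quotient (fun z => (r - z) / (1 - r^*%R * z)).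
Proof.
move=> r1; apply: Blaschke_quotient_product; exists 1, [:: r].
split=> [|w|z _]; first by rewrite normr1.
  by rewrite inE => /eqP ->.
by rewrite big_seq1 mul1r.
Qed.

Lemma Blaschke_quotient_id (R : realType) : Blaschke_quotient (@id R[i]).
Proof.
apply: (@eq_Blaschke_quotient _ (fun z => -1 * ((0 - z) / (1 - 0^*%R * z)))).
  by move=> z _; rewrite rmorph0 mul0r subr0 divr1 sub0r mulN1r opprK.
apply: Blaschke_quotient_mul; last by apply: Blaschke_quotient_factor; rewrite normr0.
by apply: Blaschke_quotient_cst; rewrite normrN1.
Qed.

Lemma Blaschke_quotient_exp (R : realType) (g : R[i] -> R[i]) (n : nat) :
  Blaschke_quotient g -> Blaschke_quotient (fun z => g z ^+ n).
Proof.
move=> hg; elim: n => [|n IH].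
  by apply: Blaschke_quotient_cst; rewrite normr1.
apply: eq_Blaschke_quotient (Blaschke_quotient_mul hg IH) => z _.
by rewrite exprS.
Qed.

(** For [|r| < 1], substituting [conj z = 1 / z] turns the function into [-z] times the Blaschke
    factor of [r]; the case [|r| > 1] reduces to this one. *)
Lemma Blaschke_quotient_XsubC (R : realType) (r : R[i]) :
  `|r| != 1 -> Blaschke_quotient (fun z => (z - r) / (z - r)^*%R).
Proof.
have ltr1 (s : R[i]) : `|s| < 1 ->
    Blaschke_quotient (fun z => (z - s) / (z - s)^*%R).
  move=> s1; apply: eq_Blaschke_quotient
    (Blaschke_quotient_mul (Blaschke_quotient_mul
       (Blaschke_quotient_cst (normrN1 _)) (@Blaschke_quotient_id R))
       (Blaschke_quotient_factor s1)) => z z1.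
  have z0 := unit_neq0 z1; rewrite rmorphB /= (conj_unit z1).
  have -> : z^-1 - s^*%R = (1 - s^*%R * z) / z by field.
  by rewrite invfM invrK; ring.
move=> r1; have [|rgt1|re1] := real_ltgtP (normr_real r) (real1 _).
- exact: ltr1.
- have r0 : r != 0 by rewrite -normr_gt0 (lt_trans ltr01).
  have rV1 : `|(r^-1)^*%R| < 1 by rewrite norm_conjC normfV invf_lt1// normr_gt0.
  (* Reflection in the circle: on it, |z - r| = |r| |z - 1 / conj r|. *)
  apply: eq_Blaschke_quotient (Blaschke_quotient_mul
    (Blaschke_quotient_mul
     (Blaschke_quotient_exp 2 (@Blaschke_quotient_id R))
     (Blaschke_quotient_cst (_ : `|r / r^*%R| = 1)))
     (Blaschke_quotient_inv (ltr1 _ rV1))) => [z z1|]; last first.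
    by rewrite normf_div norm_conjC divff// normr_eq0.
  have z0 := unit_neq0 z1; rewrite !rmorphB /= !conjCK (conj_unit z1).
  rewrite rmorphV ?unitfE//=.
  have rc0 : r^*%R != 0 by rewrite conjC_eq0.
  have zr : z - r != 0.
    rewrite subr_eq0; apply: contraTneq rgt1 => <-; by rewrite z1 ltxx.
  have zrc : z^-1 - r^*%R != 0.
    by rewrite -(conj_unit z1) -rmorphB conjC_eq0.
  have {}zrc : 1 - r^*%R * z != 0.
    have -> : 1 - r^*%R * z = z * (z^-1 - r^*%R) by field.
    by rewrite mulf_neq0.
  rewrite /=; field.
  rewrite mulNr zrc mulN1r -(opprB z) oppr_eq0 zr z0 r0 rc0 /=.
  by rewrite -opprB oppr_eq0 (mulrC z) zrc.
- by rewrite re1 eqxx in r1.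
Qed.

(** Splitting [p] into linear factors reduces to the previous case, as no root lies on the circle;
    the leading coefficient leaves a constant of modulus one. *)
Lemma Blaschke_quotient_poly (R : realType) (p : {poly R[i]}) :
  (forall z, `|z| = 1 -> p.[z] != 0) ->
  Blaschke_quotient (fun z => p.[z] / p.[z]^*%R).
Proof.
move=> p_neq0; have [rs pE] := closed_field_poly_normal p.
have p0 : p != 0.
  by apply: contraNneq (p_neq0 1 (normr1 _)) => ->; rewrite horner0.
have l0 : lead_coef p != 0 by rewrite lead_coef_eq0.
have rs1 : all (fun r => `|r| != 1) rs.
  apply/allP => r rrs; apply/eqP => /p_neq0/negP; apply.
  by rewrite -[_ == 0]/(root p r) pE rootZ// root_prod_XsubC.
apply: (@eq_Blaschke_quotient _ (fun z => lead_coef p / (lead_coef p)^*%R *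
    \prod_(r <- rs) ((z - r) / (z - r)^*%R))) => [z _|].
  rewrite {3 4}pE !hornerZ rmorphM /= horner_prod rmorph_prod big_split /=.
  rewrite prodfV mulf_div; congr (_ * _ / (_ * _)).
    by apply: eq_bigr => r _; rewrite hornerXsubC.
  by apply: eq_bigr => r _; rewrite hornerXsubC.
apply: Blaschke_quotient_mul.
  by apply: Blaschke_quotient_cst; rewrite normf_div norm_conjC divff// normr_eq0.
elim: rs rs1 {pE} => [_|r rs IH /= /andP[r1 rs1]].
  apply: eq_Blaschke_quotient (Blaschke_quotient_cst (normr1 _)) => z _.
  by rewrite big_nil.
apply: eq_Blaschke_quotient (Blaschke_quotient_mul
  (Blaschke_quotient_XsubC r1) (IH rs1)) => z _.
by rewrite big_cons.
Qed.

(* With P = q + c z^N, the function is P / conj P up to c^-1 z^-2N, because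
   conj (z^N) = z^-N on the circle. *)
Lemma Blaschke_quotient_Laurent (R : realType) (q : {poly R[i]}) (N : nat)
    (c : R[i]) : `|c| = 1 ->
  (forall z, `|z| = 1 -> `|q.[z] / z ^+ N| < 1) ->
  Blaschke_quotient (fun z =>
    (q.[z] / z ^+ N + c) / (c * (q.[z] / z ^+ N + c)^*%R)).
Proof.
move=> c1 q1; have c0 := unit_neq0 c1.
pose p := q + c *: 'X^N.
have pE z : `|z| = 1 -> q.[z] / z ^+ N + c = p.[z] / z ^+ N.
  move=> z1; rewrite /p hornerD hornerZ hornerXn mulrDl mulfK//.
  by rewrite expf_neq0// unit_neq0.
(* A zero of [p] on the circle would give [q.[z] / z ^+ N = - c], of modulus one. *)
have p0 z : `|z| = 1 -> p.[z] != 0.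
  move=> z1; apply: contraTneq (q1 z z1) => pz.
  have := pE z z1; rewrite pz mul0r => /eqP; rewrite addr_eq0 => /eqP ->.
  by rewrite normrN c1 ltxx.
have cV1 : `|c^-1| = 1 by rewrite normfV c1 invr1.
apply: eq_Blaschke_quotient (Blaschke_quotient_mul
  (Blaschke_quotient_mul (Blaschke_quotient_cst cV1)
    (Blaschke_quotient_inv
      (Blaschke_quotient_exp N.*2 (@Blaschke_quotient_id R))))
  (Blaschke_quotient_poly p0)) => z z1.
rewrite pE// rmorphM /= rmorphV ?unitfE ?expf_neq0 ?unit_neq0//= rmorphXn /=.
rewrite (conj_unit z1) exprVn invrK -addnn exprD; field.
by rewrite c0 conjC_eq0 p0// expf_neq0// unit_neq0.
Qed.

(** * Compactness of the circle and uniform continuity *)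

(** The circle is closed and lies in the continuous image of the square [[-1, 1]^2]. *)
Lemma unit_circle_compact (R : realType) : compact (@unit_circle R : set R[i]^o).
Proof.
pose phi (x : R * R) : R[i]^o := x.1 +i* x.2.
have phi_cont : continuous phi.
  move=> x; apply/cvgrPdist_lt => e e0.
  (* Radii live in [R[i]]; positivity makes them real. *)
  have eE : e = (complex.Re e)%:C by rewrite RRe_real// gtr0_real.
  have e20 : 0 < complex.Re e / 2 by rewrite divr_gt0// -ltcR -eE.
  have near1 : \forall y \near x, `|x.1 - y.1| < complex.Re e / 2.
    by apply: (cvgr_dist_lt (F := nbhs x)); [exact: cvg_fst|].
  have near2 : \forall y \near x, `|x.2 - y.2| < complex.Re e / 2.
    by apply: (cvgr_dist_lt (F := nbhs x)); [exact: cvg_snd|].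
  near=> y.
  have -> : phi x - phi y = (x.1 - y.1)%:C + 'i * (x.2 - y.2)%:C.
    by rewrite /phi; simpc.
  apply: le_lt_trans (ler_normD _ _) _.
  rewrite normrM !normc_def /= !(expr0n, expr1n, addr0, add0r) sqrtr1 mul1r.
  rewrite !sqrtr_sqr -rmorphD /= eE ltcR [ltRHS]splitr.
  by apply: ltrD; near: y.
have sub : @unit_circle R `<=` phi @` (`[-1, 1] `*` `[-1, 1]).
  move=> [a b]; rewrite /unit_circle /= normc_def => -[] /= ab1.
  have {}ab1 : a ^+ 2 + b ^+ 2 = 1.
    by rewrite -[LHS]sqr_sqrtr ?addr_ge0 ?sqr_ge0// ab1 expr1n.
  exists (a, b) => //; split => /=; rewrite in_itv /=; apply/andP; split; nra.
refine (@subclosed_compact R[i]^o _ _ _ _ sub); last first.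
  apply: continuous_compact; first exact: continuous_subspaceT.
  by apply: compact_setX; exact: segment_compact.
have -> : @unit_circle R = (Num.Def.normr : R[i]^o -> R[i]^o) @^-1` [set 1] by [].
apply: preimage_closed => [z _|]; first exact: norm_continuous.
exact/accessible_closed_set1/hausdorff_accessible/norm_hausdorff.
Unshelve. all: by end_near. Qed.

(** Heine-Cantor, with compactness used as near-covering: a property holding locally for all small
    [d > 0] holds on the whole circle for all small [d > 0]. *)
Lemma continuous_on_circle_unif (R : realType) (f : R[i] -> R[i]) (e : R) :
  continuous_on_circle f -> 0 < e ->
  exists2 d : R, 0 < d & forall x y : R[i], `|x| = 1 -> `|y| = 1 ->
    `|x - y| < d%:C -> `|f x - f y| <= e%:C.
Proof.
move=> /subspace_continuousP f_cont e0.
have /compact_near_coveringP/near_covering_withinP := @unit_circle_compact R.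
move=> cover; have unif : \forall d \near (0 : R)^'+, @unit_circle R `<=`
    (fun x => forall y, `|y| = 1 -> `|x - y| < d%:C -> `|f x - f y| <= e%:C).
  apply: cover.
  move=> x x1; have /cvgrPdist_lt/(_ (e / 2)%:C) := f_cont x x1.
  rewrite ltcR divr_gt0// => /(_ isT) /nbhs_ballP [r /= r0 fr].
  have rE : r = (complex.Re r)%:C by rewrite RRe_real// gtr0_real.
  have r20 : 0 < complex.Re r / 2 by rewrite divr_gt0// -ltcR -rE.
  (* Half the radius at [x] puts both [x'] and [y] within [r] of [x], so comparison through [f x]
     costs [e / 2] twice. *)
  exists (ball (x : R[i]^o) (complex.Re r / 2)%:C, [set d | d < complex.Re r / 2]).
    split; last exact: nbhs_right_lt.
    by apply: nbhsx_ballx; rewrite ltcR.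
  move=> [x' d] /= [xx' dr] x'1 y y1 x'y.
  have xr : `|x - x'| < r.
    by apply: lt_trans xx' _; rewrite {2}rE ltcR; lra.
  have yr : `|x - y| < r.
    rewrite (_ : x - y = (x - x') + (x' - y)); last by ring.
    apply: le_lt_trans (ler_normD _ _) _; rewrite rE [complex.Re r]splitr rmorphD.
    by rewrite ltrD//; apply: lt_trans x'y _; rewrite ltcR.
  rewrite (_ : f x' - f y = (f x - f y) - (f x - f x')); last by ring.
  apply: le_trans (ler_normB _ _) _; rewrite [e]splitr rmorphD.
  by rewrite lerD// ltW// fr.
near (0 : R)^'+ => d; exists d; first by near: d; exact: nbhs_right_gt.
by move=> x y x1; move: x x1 y; near: d.
Unshelve. all: by end_near. Qed.

Theorem theorem6p2 (R : realType) (f : R[i] -> R[i])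
    (f_cont : continuous_on_circle f)
    (f_le1 : (circle_norm f <= 1)%E)
    (eps : R) (eps_gt0 : 0 < eps) :
  exists (n : nat) (B1 B2 : 'I_n -> R[i] -> R[i]) (lambda : 'I_n -> R),
    [/\ (1 <= n)%N,
        (forall i, finite_Blaschke_product (B1 i)),
        (forall i, finite_Blaschke_product (B2 i)),
        convex_weights lambda
      & (circle_norm (fun z =>
           (\sum_(i < n) (lambda i)%:C * (B1 i z / B2 i z) - f z)%R) < eps%:E)%E].
Proof.
have f1 z : `|z| = 1 -> `|f z| <= 1.
  move=> z1; have /ereal_supP/(_ (complex.Re `|f z|)%:E) := f_le1.
  by rewrite lee_fin -lecR RRe_real ?normr_real//; apply; exists z.
(* The total error is [4 * e]: [2 * e] from the kernel, [e] from shrinking, [e] from averaging.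
   Taking [eps / 5] leaves a strict margin, and the cap keeps [1 - e] nonnegative. *)
pose e := Num.min (eps / 5) 2^-1.
have e0 : 0 < e by rewrite lt_min divr_gt0//= invr_gt0 ltr0n.
have e5 : e * 5 <= eps by rewrite -ler_pdivlMr// ge_min lexx.
have e1 : e <= 2^-1 by rewrite ge_min lexx orbT.
have [d d0 fd] := continuous_on_circle_unif f_cont e0.
pose N := Num.bound (4 / (d ^+ 2 * e)).
have NP : 4 / (d ^+ 2 * N.+1%:R) <= e.
  have := archi_boundP (ltW (_ : 0 < 4 / (d ^+ 2 * e))).
  rewrite divr_gt0 ?mulr_gt0 ?exprn_gt0// -/N => /(_ isT).
  rewrite ltr_pdivrMr ?mulr_gt0 ?exprn_gt0// => h.
  rewrite ler_pdivrMr ?mulr_gt0 ?exprn_gt0 ?ltr0n// -natr1.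
  have := exprn_gt0 2 d0; nra.
have [||x y x1 y1 xy|q qP] := @Fejer_approx _ f N d%:C e%:C f1.
- by rewrite ltcR.
- by rewrite lecR ltW.
- exact: fd.
(* Scaling by [s] bounds [|a z|] away from 1 uniformly in [z], so that one [n] serves the whole
   circle. *)
have [s [sE s0 s1]] : exists s : R, [/\ s = 1 - e, 0 <= s & s < 1].
  by exists (1 - e); split=> //; lra.
pose a z := (s%:C *: q).[z] / z ^+ N.
have aE z : a z = s%:C * (q.[z] / z ^+ N) by rewrite /a hornerZ mulrA.
have as_ z : `|z| = 1 -> `|a z| <= s%:C.
  move=> z1; have [q1 _] := qP z z1.
  by rewrite aE normrM ger0_norm ?ler_piMr ?ler0c.
have a1 z : `|z| = 1 -> `|a z| < 1.
  by move=> /as_/le_lt_trans; apply; rewrite ltcR.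
have af z : `|z| = 1 -> `|a z - f z| <= (e * 3)%:C.
  move=> z1; have [q1 qf] := qP z z1.
  rewrite (_ : a z - f z =
    (q.[z] / z ^+ N - f z) - e%:C * (q.[z] / z ^+ N)); last first.
    by rewrite aE sE rmorphB rmorph1; ring.
  apply: le_trans (ler_normB _ _) _.
  rewrite normrM (ger0_norm (_ : 0 <= e%:C)) ?lecR ?(ltW e0)//.
  apply: (@le_trans _ _ ((e + e)%:C + e%:C)); last first.
    by rewrite -rmorphD lecR; lra.
  apply: lerD; last by rewrite ler_piMr// lecR ltW.
  apply: le_trans qf _; rewrite [in leRHS]rmorphD lerD2l.
  by move: NP; rewrite -lecR !rmorphM /= fmorphV rmorphM rmorphXn !rmorph_nat.
have [n n0 nP] : exists2 n, (0 < n)%N & 2 * s ^+ n.-1 / (1 - s) <= e.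
  have ns1 : `|s| < 1 by rewrite ger0_norm.
  (* Because [1 - s = e], the target amounts to [s ^+ n.-1 <= e ^+ 2 / 2]. *)
  have /cvgrPdist_lt/(_ (e ^+ 2 / 2)) := cvg_expr ns1.
  rewrite divr_gt0 ?exprn_gt0// => /(_ isT) [m _ /(_ m (leqnn m))] /=.
  rewrite sub0r normrN ger0_norm ?exprn_ge0//.
  move=> sm; exists m.+1 => //=; rewrite (_ : 1 - s = e); last by rewrite sE; ring.
  by rewrite ler_pdivrMr// -expr2; lra.
have [w w_prim] := @closed_prim_root_exists R[i] n n0.
have w1 := norm_prim_root w_prim.
have /fin_all_exists[B1 /fin_all_exists[B2 BP]] (j : 'I_n) :
    exists B1 B2, [/\ finite_Blaschke_product B1, finite_Blaschke_product B2
    & forall z, unit_circle z ->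
      (a z + w ^+ j) / (w ^+ j * (a z + w ^+ j)^*%R) = B1 z / B2 z].
  by apply: Blaschke_quotient_Laurent => //; rewrite normrX w1 expr1n.
exists n, B1, B2, (fun=> n%:R^-1); split=> [//|j|j||].
- by case: (BP j).
- by case: (BP j).
- split=> [j|]; first by rewrite invr_ge0 ler0n invf_le1 ?ler1n ?ltr0n.
  by rewrite sumr_const card_ord -(mulr_natl n%:R^-1) mulfV// pnatr_eq0 -lt0n.
(* A pointwise strict bound would give only a large inequality for the supremum, hence the
   intermediate [e * 4]. *)
apply: le_lt_trans (_ : ((e * 4)%:E < _)%E); last by rewrite lte_fin; lra.
apply/ereal_supP => _ [z z1 <-]; rewrite lee_fin -lecR RRe_real ?normr_real//.
rewrite -mulr_sumr fmorphV rmorph_nat.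
under eq_bigr => j _ do have [_ _ <- //] := BP j.
set S := \sum_(j < n) _.
rewrite (_ : n%:R^-1 * S - f z = (n%:R^-1 * S - a z) + (a z - f z)); last by ring.
rewrite (_ : e * 4 = e + e * 3); last by ring.
rewrite rmorphD; apply: le_trans (ler_normD _ _) _; rewrite lerD ?af//.
apply: le_trans (Moebius_average w_prim (a1 z z1)) _.
(* The bound [2 * t ^+ n.-1 / (1 - t)] increases with [t], and [|a z| <= s]. *)
apply: (@le_trans _ _ (2 * s ^+ n.-1 / (1 - s))%:C); last by rewrite lecR.
have Bs0 : 0 < 1 - s by rewrite subr_gt0.
rewrite !rmorphM /= fmorphV rmorphXn rmorphB rmorph1 rmorph_nat.
rewrite ler_pM ?mulr_ge0 ?exprn_ge0 ?invr_ge0 ?subr_ge0 ?(ltW (a1 z z1))//.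
  by rewrite ler_pM2l ?ltr0n// lerXn2r ?nnegrE ?as_// ler0c.
rewrite lef_pV2 ?posrE ?subr_gt0 ?a1 ?ltcR//.
by rewrite lerD2l lerN2 as_.
Qed.
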